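(* For a universal partial word $w$ and an integer $p\ge 2$, let $\mu(w,p)$ denote the $p\times|w|$ partial matrix whose first row is $w$ and all of whose other rows consist only of $\diamond$'s. Then infinitely many nontrivial upmatrices are of the form $\mu(w,p)$, where $w$ is an upword for some $\mathcal{A}^n$ and $p\ge 2$ is an integer. In particular: (1) For all integers $a\ge 2$, $n\ge 1$ and $p\ge 2$, there are $(a!)^{a^{n-1}}$ distinct upmatrices for $\{0,\ldots,a-1\}^{p\times n}$ of the form $\mu(w,p)$, with $w$ an upword for $\{0,\ldots,a-1\}^n$, having no $\diamond$ in the top row. (2) For all integers $n\ge 2$ and $p\ge 2$, there is at least one upmatrix for $\{0,1\}^{p\times n}$ of the form $\mu(w,p)$, with $w$ an upword for $\{0,1\}^n$, having at least one $\diamond$ and at least one letter of $\{0,1\}$ in the top row. (3) For all even integers $a\ge 2$, all $n\in\{4,8\}$ and all integers $p\ge 2$, there is at least one upmatrix for $\{0,\ldots,a-1\}^{p\times n}$ of the form $\mu(w,p)$, with $w$ an upword for $\{0,\ldots,a-1\}^n$, having at least one $\diamond$ and at least one letter of $\{0,\ldots,a-1\}$ in the top row.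
   Context: An alphabet $\mathcal{A}$ is a finite nonempty set of letters, and $\diamond\notin\mathcal{A}$ is a wildcard symbol. A partial word over $\mathcal{A}$ is a finite sequence over $\mathcal{A}\cup\{\diamond\}$; $|w|$ denotes its length. A partial word $u$ covers a word $v$ at a position if $v$ is obtained from the substring of $u$ of length $|v|$ starting at that position by replacing each $\diamond$ by some letter of $\mathcal{A}$ (independently for different occurrences). A universal partial word (upword) for $\mathcal{A}^n$ is a partial word over $\mathcal{A}$ that covers every word in $\mathcal{A}^n$ exactly once, i.e. at exactly one position (upwords with no $\diamond$ are allowed). A partial matrix over $\mathcal{A}$ is a rectangular matrix with entries in $\mathcal{A}\cup\{\diamond\}$. $\mathcal{A}^{w\times\ell}$ is the set of matrices over $\mathcal{A}$ with $w$ rows and $\ell$ columns. A partial matrix covers $t\in\mathcal{A}^{w\times \ell}$ at a position if $t$ is obtained from the $w\times\ell$ block of consecutive rows and columns with top-left corner at that position by replacing each $\diamond$ by some letter of $\mathcal{A}$. A universal partial matrix (upmatrix) for $\mathcal{A}^{w\times\ell}$ is a partial matrix over $\mathcal{A}$ in which every matrix in $\mathcal{A}^{w\times\ell}$ is covered exactly once. An upmatrix for $\mathcal{A}^{w\times \ell}$ is trivial if it contains no $\diamond$, or all its entries are $\diamond$, or $w=1$ or $\ell=1$; otherwise it is nontrivial. *)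

(* Defs.v *)
From mathcomp Require Import all_boot matrix.
From mathcomp Require Import classical_sets cardinality.

Set Implicit Arguments.
Unset Strict Implicit.
Unset Printing Implicit Defensive.

Local Open Scope classical_set_scope.

(* Over an alphabet [A], the wildcard is [None : option A], and a partial word
   is a term of type [seq (option A)]. *)

(* The letter [c] can result from [x] by replacing it if it is the wildcard. *)
Definition fills (A : Type) (x : option A) (c : A) : Prop :=
  if x is Some b then b = c else True.

(* Positions count from 0. The default [None] of [nth] is never used, because
   the window has to fit inside [u]. *)
Definition word_covers (A : Type) (n : nat) (u : seq (option A))
    (v : n.-tuple A) (i : nat) : Prop :=
  i + n <= size u /\ forall k : 'I_n, fills (nth None u (i + k)) (tnth v k).

Definition upword (A : Type) (n : nat) (u : seq (option A)) : Prop :=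
  forall v : n.-tuple A, exists! i : nat, word_covers u v i.

(* The dimensions are fields, so that partial matrices of different sizes are
   members of the same type and can be collected in one set. *)
Record pmatrix (A : Type) := PMatrix {
  nrows : nat;
  ncols : nat;
  entries :> 'M[option A]_(nrows, ncols)
}.

Definition matrix_covers (A : Type) (r l : nat) (M : pmatrix A)
    (t : 'M[A]_(r, l)) (ij : nat * nat) : Prop :=
  [/\ ij.1 + r <= nrows M,
      ij.2 + l <= ncols M &
      forall (x : 'I_r) (y : 'I_l) (i : 'I_(nrows M)) (j : 'I_(ncols M)),
        i = ij.1 + x :> nat -> j = ij.2 + y :> nat -> fills (M i j) (t x y)].

Definition upmatrix (A : Type) (r l : nat) (M : pmatrix A) : Prop :=
  forall t : 'M[A]_(r, l), exists! ij : nat * nat, matrix_covers M t ij.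

Definition trivial_upmatrix (A : Type) (r l : nat) (M : pmatrix A) : Prop :=
  [\/ forall i j, M i j <> None,
      forall i j, M i j = None,
      r = 1 |
      l = 1].

Definition nontrivial_upmatrix (A : Type) (r l : nat) (M : pmatrix A) : Prop :=
  upmatrix r l M /\ ~ trivial_upmatrix r l M.

Definition mu (A : Type) (w : seq (option A)) (p : nat) : pmatrix A :=
  PMatrix (\matrix_(i < p, j < size w)
    if (i : nat) == 0 then nth None w j else None).

Definition top_row (A : Type) (M : pmatrix A) : set (option A) :=
  [set x | exists (i : 'I_(nrows M)) (j : 'I_(ncols M)),
             i = 0 :> nat /\ M i j = x].

Definition mu_upmatrix (A : Type) (p n : nat) (M : pmatrix A) : Prop :=
  upmatrix p n M /\ exists w : seq (option A), upword n w /\ M = mu w p.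

(* Main.v *)
Require Import Defs.
From mathcomp Require Import classical_sets cardinality.
From mathcomp Require Import all_boot perm all_algebra zify.

Set Implicit Arguments.
Unset Strict Implicit.
Unset Printing Implicit Defensive.

(** A block of [mu w p] that has [p] rows must start in the top row, and all its
    other rows are wildcards; so it covers a matrix exactly when the
    corresponding window of [w] covers the first row of that matrix.  Hence
    [mu w p] is an upmatrix as soon as [w] is an upword
    ([mu_upword_upmatrix]), and everything reduces to words.

    Words without wildcards.  An upword over [A] for length [m.+1] spells an
    Eulerian trail of the de Bruijn graph, whose vertices are the words of
    length [m] and whose edges are the words of length [m.+1]
    ([eulerian_total]).  These trails are counted by the argument of the BEST
    theorem.  An Eulerian trail from [v] is determined by the order in which it
    uses the edges out of each vertex, and a system of orders comes from a trail
    exactly when following the last exits leads from every vertex to [v]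
    ([run_eulerian], [eulerian_last_exit]).  With [a] letters and [N] vertices,
    there are [(a-1)!] orders with a prescribed last element, so the count is
    [(a-1)!^N] times the number of pairs (choice [f] of one exit per vertex,
    vertex [v] reached from everywhere along [f]).

    This number of pairs is [a^N] ([card_rooted_ord]).  Indeed, for a map [g] of
    a finite set to itself, the derivative at 1 of the characteristic
    polynomial of the matrix of [g] is the number of points reached from
    everywhere ([deriv_char_poly_funmx]): it is a sum of determinants in which
    one row is replaced, and each of these is 1 or 0 according to whether the
    point of that row is reached from everywhere ([det_unrooted]).  By
    multilinearity in the rows, the sum over all choices [f] is [a^N] times the
    characteristic polynomial of the transition matrix of the random walk
    ([sum_char_poly_funmx]).  In a de Bruijn graph, the walk is uniformly
    distributed after [m] steps, so the transition matrix is a projection of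
    rank one plus a nilpotent matrix that it annihilates, and its characteristic
    polynomial is that of the projection, [X^(N-1) * (X-1)].

    Wildcards over two letters.  In [m] wildcards followed by one 0 and [m.+1]
    ones, the window that covers a word is given by the place of its last 0
    ([upword_diamonds_first]).

    Wildcards over an even alphabet.  A cyclic upword over two letters, whose
    wildcards are exactly the positions congruent to [-1] modulo the window
    length, is lifted to the alphabet [bool * B] ([upcycle_lift]).  Its letters
    are paired with the terms of a periodic sequence over [B] in which every
    word of length [m.+1] occurs exactly once at positions of each residue
    modulo the number of letters in one period ([perfect_necklace]); such a
    sequence is an Eulerian trail of a de Bruijn graph times a directed cycle.
    Cyclic upwords over two letters for the lengths 4 and 8 are given
    explicitly and checked by computation. *)

(** * Eulerian trails and exit orders *)

Section Trails.
Variables (V A : finType) (step : V -> A -> V).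

Fixpoint trail v (w : seq A) : seq (V * A) :=
  if w is c :: w' then (v, c) :: trail (step v c) w' else [::].

Definition exits v w x := [seq e.2 | e <- trail v w & e.1 == x].

Definition eulerian v w := uniq (trail v w) && (size w == #|V| * #|A|).

Lemma size_trail v w : size (trail v w) = size w.
Proof. by elim: w v => //= c w IHw v; rewrite IHw. Qed.

Lemma exits_cons v c w x :
  exits v (c :: w) x =
  if v == x then c :: exits (step v c) w x else exits (step v c) w x.
Proof. by rewrite /exits /=; case: ifP. Qed.

Lemma size_exits v w x :
  size (exits v w x) = count (fun e => e.1 == x) (trail v w).
Proof. by rewrite /exits size_map size_filter. Qed.

Lemma mem_exits v w x c : (c \in exits v w x) = ((x, c) \in trail v w).
Proof.
apply/mapP/idP => [[[y d]]|xc]; last by exists (x, c); rewrite ?mem_filter ?eqxx.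
by rewrite mem_filter /= => /andP[/eqP -> ?] ->.
Qed.

Lemma uniq_exits v w x : uniq (trail v w) -> uniq (exits v w x).
Proof.
move=> uw; rewrite map_inj_in_uniq ?filter_uniq // => -[y c] [z d].
by rewrite !mem_filter /= => /andP[/eqP -> _] /andP[/eqP -> _] ->.
Qed.

Lemma trail_uniq v w : (forall x, uniq (exits v w x)) -> uniq (trail v w).
Proof.
move=> ue; apply: count_mem_uniq => -[x c].
rewrite -mem_exits -count_uniq_mem // /exits count_map count_filter.
by apply: eq_count => -[y d] /=; rewrite xpair_eqE andbC.
Qed.

(** Along a trail, arrivals and departures at [x] alternate; they can differ
    only by the two ends of the trail. *)
Lemma flow v w x :
  count (fun e => step e.1 e.2 == x) (trail v w) + (v == x) =
  count (fun e => e.1 == x) (trail v w) + (foldl step v w == x).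
Proof.
elim: w v => [|c w IHw] v //=.
by rewrite [(step v c == x) + _]addnC IHw addnC addnA.
Qed.

Lemma count_uniq_le (T : finType) (p : pred T) (s : seq T) :
  uniq s -> count p s <= #|p|.
Proof.
move=> us; rewrite -size_filter -(card_uniqP (filter_uniq p us)).
by apply/subset_leq_card/subsetP => y; rewrite mem_filter => /andP[].
Qed.

Lemma count_uniq_full (T : finType) (p : pred T) (s : seq T) :
  uniq s -> #|p| <= count p s -> forall y, p y -> y \in s.
Proof.
move=> us le_ps y py.
have /subset_cardP E : #|filter p s| = #|p|.
  apply/eqP; rewrite (card_uniqP (filter_uniq p us)) size_filter.
  by rewrite eqn_leq le_ps count_uniq_le.
have /E/(_ y) : filter p s \subset p by apply/subsetP => z; rewrite mem_filter => /andP[].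
by rewrite mem_filter [y \in p]py => /andP[].
Qed.

Lemma card_out x : #|[pred e : V * A | e.1 == x]| = #|A|.
Proof.
rewrite -(card_imset predT (f := pair x)); last by move=> c d [].
apply: eq_card => -[y c]; rewrite !inE /=; apply/eqP/imsetP => [->|[d _ [-> _]]] //.
by exists c.
Qed.

Lemma eulerian_mem v w e : eulerian v w -> e \in trail v w.
Proof.
case/andP=> uw /eqP sw; apply: (count_uniq_full (p := predT)) => //.
by rewrite count_predT size_trail sw -card_prod.
Qed.

Lemma eulerian_count v w (p : pred (V * A)) :
  eulerian v w -> count p (trail v w) = #|p|.
Proof.
move=> Ew; have /andP[uw _] := Ew; rewrite -size_filter.
rewrite -(card_uniqP (filter_uniq p uw)); apply: eq_card => e.
by rewrite mem_filter eulerian_mem // andbT.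
Qed.

Hypothesis balanced : forall x, #|[pred e : V * A | step e.1 e.2 == x]| = #|A|.

Lemma eulerian_closed v w : eulerian v w -> foldl step v w = v.
Proof.
move=> Ew; have := flow v w v.
rewrite !eulerian_count // card_out (balanced v) eqxx.
by move/addnI; case: eqP.
Qed.

Lemma size_exits_eulerian v w x : eulerian v w -> size (exits v w x) = #|A|.
Proof. by move=> Ew; rewrite size_exits eulerian_count ?card_out. Qed.

(** The walk that leaves each vertex by the first letter not yet spent in the
    list [s] of that vertex, until [n] steps are made or the list is empty. *)
Fixpoint run n v (s : V -> seq A) : seq A :=
  if n is n'.+1 then
    if s v is c :: r then
      c :: run n' (step v c) (fun x => if v == x then r else s x)
    else [::]
  else [::].

Lemma run_exits v w s : s =1 exits v w -> run (size w) v s = w.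
Proof.
elim: w v s => [|c w IHw] v s //= Es.
rewrite Es exits_cons eqxx; congr (_ :: _); apply: IHw => x.
rewrite Es exits_cons; case: eqP => [->|] //.
Qed.

(** What [run] has not spent is a final segment of each list; this and
    [run_stuck] describe it without naming the remaining lists. *)
Lemma run_prefix n v s x : prefix (exits v (run n v s) x) (s x).
Proof.
elim: n v s => [|n IHn] v s /=; first exact: prefix0s.
case Esv: (s v) => [|c r]; first exact: prefix0s.
rewrite exits_cons.
have:= IHn (step v c) (fun x => if v == x then r else s x).
by case: eqP => [<-|] //; rewrite Esv prefix_cons eqxx.
Qed.

Lemma run_stuck n v s (w := run n v s) :
  size w < n -> exits v w (foldl step v w) = s (foldl step v w).
Proof.
rewrite {}/w; elim: n v s => [|n IHn] v s //=.
case Esv: (s v) => [|c r] //= /IHn {IHn}.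
set s' := fun x => _; set w := run n _ s'; rewrite exits_cons => ->.
by rewrite /s'; case: eqP => // <-.
Qed.

Lemma prefix_size_eq (s1 s2 : seq A) :
  prefix s1 s2 -> size s2 <= size s1 -> s1 = s2.
Proof.
case/prefixP=> s ->; rewrite size_cat -{2}[size s1]addn0 leq_add2l leqn0.
by move/nilP->; rewrite cats0.
Qed.

Variable c0 : A.

(** By balance, the walk can only get stuck at its start [v], after every edge
    into [v] has been used.  If all the edges into a vertex [y] are used and the
    last exit of [x] leads to [y], then this last exit is used, hence so are all
    the exits of [x] and, by balance, all the edges into [x].  Since last exits
    lead from everywhere to [v], the walk has used every edge. *)
Lemma run_eulerian v s (w := run (#|V| * #|A|) v s) :
    (forall x, uniq (s x)) -> (forall x, size (s x) = #|A|) ->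
    (forall x, fconnect (fun x => step x (last c0 (s x))) x v) ->
  eulerian v w /\ exits v w =1 s.
Proof.
move=> us ss conn.
have pref x : prefix (exits v w x) (s x) by exact: run_prefix.
have uw : uniq (trail v w).
  apply: trail_uniq => x; have /prefixP[r Er] := pref x.
  by have := us x; rewrite Er cat_uniq => /andP[].
have A0 : 0 < #|A| by apply/card_gt0P; exists c0.
have Ew : eulerian v w.
  rewrite /eulerian uw /=; rewrite eqn_leq -{1}(size_trail v w) -card_prod.
  rewrite -(card_uniqP uw) max_card /= leqNgt card_prod.
  (* With fewer steps than edges, the walk would be stuck. *)
  apply/negP => lt_w; have stuck := run_stuck lt_w; rewrite -/w in stuck.
  have end_v : foldl step v w = v.
    have := flow v w (foldl step v w).
    rewrite -size_exits stuck ss eqxx.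
    have := count_uniq_le [pred e | step e.1 e.2 == foldl step v w] uw.
    rewrite (balanced (foldl step v w)) /=; case: eqP => // _.
    by rewrite addn0 addn1 => /[swap] ->; rewrite ltnn.
  have bal x : count (fun e => step e.1 e.2 == x) (trail v w) = size (exits v w x).
    by have := flow v w x; rewrite end_v size_exits => /addIn.
  have full x : exits v w x = s x.
    have /iter_findex := conn x; set g := fun _ => _.
    move: (findex g x v) => k; elim: k x => [|k IHk] x.
      by move=> /= ->; rewrite end_v in stuck.
    rewrite iterSr => /IHk Eg; apply: prefix_size_eq => //.
    have last_in : (x, last c0 (s x)) \in trail v w.
      apply: (count_uniq_full (p := [pred e | step e.1 e.2 == g x])) => //=.
      by rewrite (balanced (g x)) (bal (g x)) Eg ss.
    have /prefixP[r Er] := pref x; rewrite Er size_cat.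
    move: last_in; rewrite -mem_exits Er last_cat.
    case: r Er => [|d r] Er /=; first by rewrite addn0.
    by have := us x; rewrite Er cat_uniq => /and3P[_ /hasPn/(_ _ (mem_last d r))/negP].
  have : #|{: V * A}| <= size (trail v w).
    rewrite -(card_uniqP uw); apply/subset_leq_card/subsetP => -[x c] _.
    rewrite -mem_exits full.
    have := max_card (mem (s x)); have := card_uniqP (us x).
    rewrite ss => Es _; have /subset_cardP/(_ (subset_predT _)) : #|s x| = #|A| by [].
    by move/(_ c) => ->.
  by rewrite card_prod size_trail leqNgt lt_w.
split=> // x; apply: prefix_size_eq => //.
by rewrite ss size_exits_eulerian.
Qed.

(** After its last exit from [x], a trail is either at its end or at a vertex
    from which it exits for the last time still later.  The map [g] is a
    parameter so that it stays the same when the trail is shortened. *)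
Lemma last_exit_connect v w g :
    (forall x, exits v w x != [::] -> g x = step x (last c0 (exits v w x))) ->
  forall x, exits v w x != [::] -> fconnect g x (foldl step v w).
Proof.
elim: w v => [|c w IHw] v //= Eg x.
set v1 := step v c in IHw *.
have {}IHw y : exits v1 w y != [::] -> fconnect g y (foldl step v1 w).
  apply: IHw => z nz; have := Eg z; rewrite exits_cons -/v1.
  case: (v == z) => [/(_ isT) ->|/(_ nz)] //=.
  by case: (exits v1 w z) nz.
have [nx|] := boolP (exits v1 w x != [::]); first by move=> _; apply: IHw.
rewrite negbK => /eqP Ex; have := Eg x; rewrite exits_cons -/v1 Ex.
case: (altP (v =P x)) => [<-|] // /(_ isT) /= gv _; apply: connect_trans (connect1 _) _.
  by rewrite /= gv.
rewrite -/v1; case: w IHw {Ex Eg} => [|d w] IHw; first exact: connect0.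
by apply: IHw; rewrite exits_cons eqxx.
Qed.

Lemma eulerian_last_exit v w : eulerian v w ->
  forall x, fconnect (fun x => step x (last c0 (exits v w x))) x v.
Proof.
move=> Ew x; rewrite -{2}(eulerian_closed Ew).
apply: last_exit_connect => //.
rewrite -size_eq0 size_exits_eulerian // -lt0n.
by apply/card_gt0P; exists c0.
Qed.

Definition tours := [set p : V * (#|V| * #|A|).-tuple A | eulerian p.1 p.2].

(** The edges chosen by [p.2] at the vertices other than [p.1] form a spanning
    tree oriented towards [p.1]; the edge chosen at [p.1] is arbitrary. *)
Definition rooted (p : V * {ffun V -> A}) :=
  [forall x, fconnect (fun x => step x (p.2 x)) x p.1].

(** These turn out to be the exit orders of the Eulerian trails, each paired with
    the start of the trail. *)
Definition schedules := [set p : V * {ffun V -> #|A|.-tuple A} |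
  [forall x, uniq (p.2 x)] && rooted (p.1, [ffun x => last c0 (p.2 x)])].

Lemma rootedP v (h : V -> A) :
  reflect (forall x, fconnect (fun x => step x (h x)) x v)
          (rooted (v, [ffun x => h x])).
Proof.
have E x : fconnect (fun x => step x ([ffun x => h x] x)) x v
         = fconnect (fun x => step x (h x)) x v.
  by apply: eq_connect => y z /=; rewrite ffunE.
by apply: (iffP forallP) => H x; have := H x; rewrite E.
Qed.

(** [exits] and [run] are inverse to each other. *)
Lemma card_tours_schedules : #|tours| = #|schedules|.
Proof.
pose G (p : V * (#|V| * #|A|).-tuple A) : {ffun V -> #|A|.-tuple A} :=
  [ffun x => insubd (enum_tuple A) (exits p.1 p.2 x)].
pose F p := (p.1, G p).
have GE p x : p \in tours -> G p x = exits p.1 p.2 x :> seq A.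
  rewrite inE => Ep; rewrite ffunE val_insubd.
  by rewrite size_exits_eulerian // eqxx.
suff -> : schedules = F @: tours.
  rewrite card_in_imset // => -[v w] [v' w'] pT pT' EF.
  move: EF pT' => [<-] EG pT'.
  congr (_, _); apply/val_inj => /=.
  have := @run_exits v w' (exits v w); rewrite size_tuple => <- //; last first.
    by move=> x; rewrite -(GE _ x pT') -EG GE.
  by rewrite -{1}[in RHS](size_tuple w) run_exits.
apply/setP => -[v s]; apply/idP/imsetP => [|[[v' w] pT [-> ->]]].
  rewrite inE /= => /andP[/forallP us /rootedP conn].
  have [Ew Ex] := run_eulerian us (fun x => size_tuple (s x)) conn.
  set w := run _ _ _ in Ew Ex; have /andP[_ sw] := Ew.
  exists (v, Tuple sw); rewrite ?inE //; congr (_, _); apply/ffunP => x.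
  by apply/val_inj => /=; rewrite GE ?inE //= Ex.
have := pT; rewrite inE /= => Ew; rewrite inE /=; apply/andP; split.
  by apply/forallP => x; rewrite GE // uniq_exits //; case/andP: Ew.
apply/rootedP => x.
rewrite (eq_connect (_ : _ =2 frel (fun x => step x (last c0 (exits v' w x))))).
  exact: eulerian_last_exit.
by move=> y z /=; rewrite GE.
Qed.

(** The number does not depend on [c], since transposing letters permutes the
    orderings, and these numbers add up to [#|A|`!]. *)
Lemma card_uniq_last c :
  #|[pred t : #|A|.-tuple A | uniq t & last c0 t == c]| = (#|A|.-1)`!.
Proof.
have A0 : 0 < #|A| by apply/card_gt0P; exists c0.
pose K d := #|[pred t : #|A|.-tuple A | uniq t & last c0 t == d]|.
have lastN0 (t : #|A|.-tuple A) d e : last d t = last e t.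
  have : 0 < size t by rewrite size_tuple.
  by case: (tval t).
have K_le d e : K d <= K e.
  have inj : injective (map_tuple (n := #|A|) (tperm d e)).
    by move=> s t /(congr1 val) /(inj_map perm_inj) /val_inj.
  rewrite /K -(card_imset _ inj); apply/subset_leq_card/subsetP => t.
  case/imsetP => s; rewrite !inE => /andP[us /eqP ls] -> /=.
  rewrite map_inj_uniq ?us; last exact: perm_inj.
  rewrite (lastN0 (map_tuple (tperm d e) s) c0 (tperm d e c0)) /= last_map ls.
  by rewrite tpermL eqxx.
have K_eq d : K d = K c by apply/eqP; rewrite eqn_leq !K_le.
apply/eqP; rewrite -(eqn_pmul2l A0) -[X in _ == X * _](prednK A0) -factS prednK //.
have := card_uniq_tuples #|A| (predT : pred A); rewrite -ffactnn => <-.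
rewrite -sum1dep_card (partition_big (fun t : #|A|.-tuple A => last c0 t) predT) //=.
rewrite (eq_bigr (fun=> K c)) ?sum_nat_const // => d _.
rewrite -(K_eq d) sum1dep_card; apply: eq_card => t; rewrite !inE.
by rewrite (introT allP).
Qed.

Lemma card_schedules :
  #|schedules| = #|[set p | rooted p]| * (#|A|.-1)`! ^ #|V|.
Proof.
pose lasts (p : V * {ffun V -> #|A|.-tuple A}) : V * {ffun V -> A} :=
  (p.1, [ffun x => last c0 (p.2 x)]).
rewrite -sum1_card (partition_big lasts [pred p | rooted p]) /=; last first.
  by move=> p; rewrite inE => /andP[].
rewrite -sum_nat_const; apply: eq_big => [p|[v f] /= fP]; first by rewrite inE.
rewrite sum1dep_card.
pose B : {set {ffun V -> #|A|.-tuple A}} :=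
  [set s in family (fun x => [pred t : #|A|.-tuple A | uniq t & last c0 t == f x])].
transitivity #|pair v @: B|.
  apply: eq_card => -[u s]; rewrite !inE; apply/andP/imsetP.
    case=> /andP[/forallP us _] /eqP[-> Ef]; exists s => //.
    by rewrite inE; apply/familyP => x; rewrite !inE us -Ef ffunE eqxx.
  case=> s'; rewrite inE => /familyP s'P [-> ->].
  have Ef : [ffun x => last c0 (s' x)] = f.
    by apply/ffunP => x; rewrite ffunE; have := s'P x; rewrite !inE => /andP[_ /eqP].
  rewrite /lasts /= Ef eqxx fP andbT; split=> //.
  by apply/forallP => x; have := s'P x; rewrite !inE => /andP[].
rewrite card_imset; last by move=> ? ? [].
rewrite cardsE card_family foldrE big_map big_enum /=.
by rewrite (eq_bigr (fun=> (#|A|.-1)`!)) ?prod_nat_const // => x _; rewrite card_uniq_last.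
Qed.

(** The BEST theorem for a balanced graph with constant out-degree. *)
Theorem card_tours : #|tours| = #|[set p | rooted p]| * (#|A|.-1)`! ^ #|V|.
Proof. by rewrite card_tours_schedules card_schedules. Qed.
End Trails.

(** * Characteristic polynomials and rooted choices *)

Section Determinants.
Import GRing.Theory Num.Theory.
Local Open Scope ring_scope.

Lemma deriv_prod_seq (R : comNzRingType) (I : eqType) (r : seq I) (F : I -> {poly R}) :
  uniq r ->
  (\prod_(i <- r) F i)^`() =
  \sum_(i <- r) (F i)^`() * \prod_(j <- r | j != i) F j.
Proof.
elim: r => [|k r IHr] /=; first by rewrite !big_nil derivC.
case/andP=> kr /IHr {}IHr; rewrite big_cons derivM {}IHr.
rewrite [RHS]big_cons big_cons eqxx; congr (_ * _ + _).
  rewrite [LHS]big_seq [RHS]big_seq_cond; apply: eq_bigl => j.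
  by case: (boolP (j \in r)) => //= jr; apply/esym; apply: contraNneq kr => <-.
rewrite mulr_sumr; apply: eq_big_seq => i ir; rewrite big_cons.
have -> : k != i by apply: contraNneq kr => ->.
by rewrite mulrCA.
Qed.

Lemma deriv_det (R : comNzRingType) n (A : 'M[{poly R}]_n) :
  (\det A)^`() =
  \sum_i \det (\matrix_(k, l) if k == i then (A k l)^`() else A k l).
Proof.
rewrite /determinant raddf_sum exchange_big /=; apply: eq_bigr => s _.
have signE b : ((-1) ^+ b : {poly R}) = ((-1) ^+ b)%:P by rewrite rmorph_sign.
rewrite signE derivM derivC mul0r add0r deriv_prod_seq ?index_enum_uniq // mulr_sumr.
apply: eq_bigr => i _; congr (_ * _).
rewrite [RHS](bigD1 i) //= mxE eqxx; congr (_ * _).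
by apply: eq_bigr => j /negPf ji; rewrite mxE ji.
Qed.

(** As [X - A] divides the scalar matrix [X^m], its determinant is a monic
    divisor of a power of [X]. *)
Lemma char_poly_nilpotent (F : fieldType) n (A : 'M[F]_n) m :
  A ^+ m = 0 -> char_poly A = 'X^n.
Proof.
move=> Am.
pose X : 'M[{poly F}]_n := 'X%:M; pose B := map_mx polyC A.
have BX : GRing.comm X B by apply: comm_scalar_mx.
have BE k : B ^+ k = map_mx polyC (A ^+ k).
  elim: k => [|k IHk]; first by rewrite !expr0 map_mx1.
  by rewrite !exprS IHk -[LHS]/(_ *m _) -map_mxM.
have Bm : B ^+ m = 0 by rewrite BE Am map_mx0.
have := subrXX_comm m BX; rewrite Bm subr0 -/(X - B) /X -rmorphXn /=.
move/(congr1 determinant); rewrite -[X in _ = X]/(\det (_ *m _)) det_mulmx det_scalar.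
rewrite -exprM -[\det (_ - _)]/(char_poly A) => E.
have : char_poly A %| ('X - 0%:P) ^+ (m * n) by rewrite subr0 E dvdp_mulr.
case/dvdp_exp_XsubCP => k _; rewrite subr0 eqp_monic ?char_poly_monic ?monicXn //.
move=> /eqP Ek; have := size_char_poly A; rewrite Ek size_polyXn => -[<-] //.
Qed.

Lemma horner_char_poly (R : comNzRingType) n (A : 'M[R]_n) a :
  (char_poly A).[a] = \det (a%:M - A).
Proof.
rewrite -[_.[a]]/(horner_eval a _) -det_map_mx; congr (\det _).
by apply/matrixP => i j; rewrite !mxE /= /horner_eval hornerD hornerN hornerMn hornerX hornerC.
Qed.

Lemma det_sum_rows (R : comNzRingType) (A : finType) n (F : 'I_n -> A -> 'I_n -> R) :
  \det (\matrix_(i, j) \sum_c F i c j) =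
  \sum_(f : {ffun 'I_n -> A}) \det (\matrix_(i, j) F i (f i) j).
Proof.
rewrite /determinant exchange_big /=; apply: eq_bigr => s _.
under eq_bigr do rewrite mxE.
rewrite bigA_distr_bigA mulr_sumr; apply: eq_bigr => f _; congr (_ * _).
by apply: eq_bigr => i _; rewrite mxE.
Qed.

(** Both sides are the determinant of [block_mx 1 v u B] times that of
    [block_mx t 0 (- u) 1]: the hypothesis makes the product of these matrices
    upper triangular. *)
Lemma det_rank1_update (R : idomainType) n (B : 'M[R]_n) (u : 'cV_n) (v : 'rV_n) t :
  B *m u = t *: u -> t * \det (B - u *m v) = (t - (v *m u) 0 0) * \det B.
Proof.
move=> Bu.
have := mulmx_block 1%:M v u B t%:M 0 (- u) 1%:M.
have := mulmx_block 1%:M 0 u 1%:M 1%:M v 0 (B - u *m v).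
rewrite !mulmx1 !mul1mx !mulmx0 !mul0mx !addr0 mulmxN mulmxN Bu.
rewrite [_ + (B - _)]addrC subrK mul_mx_scalar subrr !add0r => <-.
move/(congr1 determinant); rewrite !det_mulmx !det_ublock !det_lblock.
rewrite !det1 !mul1r !mulr1 det_scalar1 mulrC => ->; congr (_ * _).
by rewrite det_mx11 !mxE eqxx mulr1n.
Qed.

Section Functional.
Variables (n : nat) (g : 'I_n -> 'I_n).

Definition funmx : 'M[rat]_n := \matrix_(i, j) (g i == j)%:R.

(** If [v] is reached from everywhere, the matrix is the identity minus the
    nilpotent matrix of [g] stopped at [v].  Otherwise it kills the indicator
    vector of the points that do not reach [v]. *)
Lemma det_unrooted v :
  \det (\matrix_(k, l) if k == v then (k == l)%:R else (k == l)%:R - (g k == l)%:R) =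
  [forall x, fconnect g x v]%:R :> rat.
Proof.
case: forallP => [conn|/forallP]; last first.
  rewrite negb_forall => /existsP[x0 nx0].
  apply/eqP; rewrite -det_tr; apply/det0P.
  exists (\row_j (~~ fconnect g j v)%:R).
    by apply/eqP => /rowP/(_ x0)/eqP; rewrite !mxE nx0 oner_eq0.
  apply/rowP => k; rewrite !mxE.
  have sumE h : \sum_j (~~ fconnect g j v)%:R * (h == j)%:R = (~~ fconnect g h v)%:R :> rat.
    rewrite (bigD1 h) //= eqxx mulr1 big1 ?addr0 // => j /negPf jh.
    by rewrite eq_sym jh mulr0.
  have [->|kv] := eqVneq k v.
    rewrite (eq_bigr (fun j => (~~ fconnect g j v)%:R * (v == j)%:R)) => [|j _].
      by rewrite sumE connect0.
    by rewrite !mxE eqxx.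
  under eq_bigr do rewrite !mxE (negPf kv) mulrBr.
  rewrite sumrB !sumE; apply/eqP; rewrite subr_eq0; apply/eqP; congr (~~ _)%:R.
  apply/idP/idP => [/iter_findex|]; last by apply: connect_trans; apply: fconnect1.
  case: (findex g k v) => [/= /eqP|i]; first by rewrite (negPf kv).
  by rewrite iterSr => <-; apply: fconnect_iter.
pose T : 'M[rat]_n := \matrix_(k, l) if k == v then 0 else (g k == l)%:R.
have Tnil m k l i : (i < m)%N -> iter i g k = v -> (T ^+ m) k l = 0.
  elim: m k i => [|m IHm] k i //; rewrite exprS ltnS => im Ek.
  rewrite -[_ * _]/(_ *m _) mxE.
  have [kv|kv] := eqVneq k v; first by apply: big1 => j _; rewrite mxE kv eqxx mul0r.
  rewrite (bigD1 (g k)) //= mxE (negPf kv) eqxx mul1r big1 => [|j /negPf jg].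
    rewrite addr0; case: i im Ek => [|i] im; first by move/eqP; rewrite /= (negPf kv).
    by rewrite iterSr => Ek; apply: IHm im Ek.
  by rewrite mxE (negPf kv) eq_sym jg mul0r.
have T0 : T ^+ (\max_k findex g k v).+1 = 0.
  apply/matrixP => k l; rewrite [RHS]mxE.
  apply: (Tnil _ _ _ (findex g k v)); rewrite ?iter_findex // ltnS.
  exact: (@leq_bigmax _ (fun k => findex g k v)).
transitivity (char_poly T).[1]; last by rewrite (char_poly_nilpotent T0) hornerXn expr1n.
rewrite horner_char_poly; congr (\det _); apply/matrixP => k l; rewrite !mxE.
by case: ifP; rewrite ?subr0.
Qed.

(** Differentiating one row of [X - funmx] leaves a row of the identity. *)
Lemma deriv_char_poly_funmx :
  (char_poly funmx)^`().[1] = #|[set v | [forall x, fconnect g x v]]|%:R.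
Proof.
rewrite /char_poly deriv_det -[_.[1]]/(horner_eval 1 _) raddf_sum -sum1_card natr_sum.
rewrite [RHS]big_mkcond /=; apply: eq_bigr => v _.
rewrite inE -mulrb -det_unrooted -det_map_mx; congr (\det _).
apply/matrixP => k l; rewrite !mxE; case: ifP => _; rewrite ?derivE /= /horner_eval.
  by rewrite subr0 -polyC_natr hornerC.
by rewrite hornerD hornerN hornerMn hornerX hornerC.
Qed.
End Functional.

Section Choices.
Variables (n : nat) (A : finType) (step : 'I_n -> A -> 'I_n).
Let a : rat := #|A|%:R.

(** The transition matrix of the walk that follows a uniformly random letter. *)
Definition transition : 'M[rat]_n := a^-1 *: \sum_c funmx (step^~ c).

Lemma sum_char_poly_funmx : (0 < #|A|)%N ->
  \sum_(f : {ffun 'I_n -> A}) char_poly (funmx (fun x => step x (f x))) =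
  (a ^+ n)%:P * char_poly transition.
Proof.
move=> A0; have a0 : a != 0 by rewrite pnatr_eq0 -lt0n.
pose F i c j : {poly rat} := 'X *+ (i == j) - (step i c == j)%:R%:P.
transitivity (\sum_(f : {ffun 'I_n -> A}) \det (\matrix_(i, j) F i (f i) j)).
  by apply: eq_bigr => f _; congr (\det _); apply/matrixP => i j; rewrite !mxE.
rewrite -det_sum_rows rmorphXn /= -detZ; congr (\det _); apply/matrixP => i j.
rewrite !mxE sumrB sumr_const mulrBr -rmorphM /= mulrA mulfV // mul1r summxE.
rewrite rmorph_sum /=; congr (_ - _); last by apply: eq_bigr => c _; rewrite mxE.
by rewrite /a polyC_natr mulr_natl.
Qed.

Lemma funmx_sum_exp m i j :
  ((\sum_c funmx (step^~ c)) ^+ m) i j =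
  #|[set w : m.-tuple A | foldl step i w == j]|%:R.
Proof.
elim: m i j => [|m IHm] i j.
  rewrite expr0 mxE.
  have -> : [set w : 0.-tuple A | foldl step i w == j] = if i == j then setT else set0.
    by apply/setP => w; rewrite tuple0 !inE /=; case: eqP; rewrite inE.
  by case: eqP; rewrite ?cards0 // cardsT card_tuple.
rewrite exprS -[_ * _]/(_ *m _) mxE.
transitivity (\sum_c #|[set w : m.-tuple A | foldl step (step i c) w == j]|%:R : rat).
  under eq_bigr do rewrite summxE mulr_suml.
  rewrite exchange_big; apply: eq_bigr => c _.
  rewrite (bigD1 (step i c)) //= mxE eqxx mul1r IHm big1 ?addr0 // => k /negPf kc.
  by rewrite mxE eq_sym kc mul0r.
rewrite -natr_sum; congr _%:R.
rewrite -sum1dep_card (partition_big (@thead _ _) predT) //=; apply: eq_bigr => c _.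
rewrite sum1dep_card.
transitivity #|cons_tuple c @: [set w : m.-tuple A | foldl step (step i c) w == j]|.
  by rewrite card_imset // => s t /(congr1 val)[] /val_inj.
apply: eq_card => w; rewrite [w]tuple_eta !inE theadE /=; apply/imsetP/andP.
  by case=> t; rewrite inE => Et /(congr1 val)/= [-> ->].
case=> Et /eqP Ec; exists (behead_tuple w); rewrite ?inE -?Ec //.
Qed.

(** Let [P] be the projection onto the constant vectors, with all entries equal.
    The hypothesis says that the [m]-th power of [transition] is [P], so
    [transition - P] is nilpotent and kills constants; a rank one update then
    gives [X * char_poly transition = (X - 1) * X^n]. *)
Lemma card_rooted_ord m : (0 < n)%N -> (0 < #|A|)%N ->
    (forall i j, #|[set w : m.-tuple A | foldl step i w == j]| = 1)%N ->
  #|[set p : 'I_n * {ffun 'I_n -> A} |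
       [forall x, fconnect (fun x => step x (p.2 x)) x p.1]]| = (#|A| ^ n)%N.
Proof.
move=> n0 A0 unique_walk.
have a0 : a != 0 by rewrite pnatr_eq0 -lt0n.
have n_exp : n = (#|A| ^ m)%N.
  pose i := Ordinal n0; rewrite -card_tuple -cardsT -sum1_card.
  rewrite (partition_big (fun w : m.-tuple A => foldl step i w) predT) //=.
  rewrite (eq_bigr (fun=> 1%N)) ?sum1_card ?card_ord // => j _.
  rewrite -{2}(unique_walk i j) -sum1_card; apply: eq_bigl => w.
  by rewrite !inE.
have nQ : n%:R != 0 :> rat by rewrite pnatr_eq0 -lt0n.
(* [P] is [u *m v]. *)
pose u : 'cV[rat]_n := const_mx 1; pose v : 'rV[rat]_n := const_mx n%:R^-1.
have vu : v *m u = 1%:M.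
  apply/rowP => i; rewrite !ord1 !mxE (eq_bigr (fun=> n%:R^-1)).
    by rewrite sumr_const card_ord -[LHS]mulr_natl mulfV.
  by move=> j _; rewrite !mxE mulr1.
have Ku : transition *m u = u.
  rewrite -scalemxAl mulmx_suml (eq_bigr (fun=> u)) => [|c _].
    by rewrite sumr_const -scaler_nat scalerA mulVf // scale1r.
  apply/colP => i; rewrite !mxE (bigD1 (step i c)) //= !mxE eqxx mulr1.
  by rewrite big1 ?addr0 // => j /negPf jc; rewrite mxE eq_sym jc mul0r.
have expK k : transition ^+ k = a^-1 ^+ k *: (\sum_c funmx (step^~ c)) ^+ k.
  elim: k => [|k IHk]; first by rewrite !expr0 scale1r.
  rewrite !exprS IHk -!/(mulmx _ _) -![_ * _ in LHS]/(_ *m _).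
  by rewrite -scalemxAr -scalemxAl scalerA [_ * a^-1]mulrC.
have Km : transition ^+ m = u *m v.
  rewrite expK; apply/matrixP => i j; rewrite !mxE funmx_sum_exp unique_walk.
  by rewrite big_ord1 !mxE mul1r mulr1 n_exp natrX exprVn.
have KP : transition * (u *m v) = u *m v by rewrite -[LHS]/(_ *m _) mulmxA Ku.
have PK : (u *m v) * transition = u *m v by rewrite -{1}Km -exprSr exprS Km.
have PP : (u *m v) * (u *m v) = u *m v.
  by rewrite -[LHS]/(_ *m _) mulmxA -(mulmxA u) vu mulmx1.
have Texp k : (transition - u *m v) ^+ k.+1 = transition ^+ k.+1 - u *m v.
  elim: k => [|k IHk]; first by rewrite !expr1.
  have PKk : u *m v * transition ^+ k.+1 = u *m v.
    by elim: k {IHk} => [|k IHk]; rewrite ?expr1 // exprSr mulrA IHk.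
  by rewrite exprS IHk mulrBl !mulrBr KP PP PKk subrr subr0 -exprS.
have T0 : (transition - u *m v) ^+ m.+1 = 0.
  by rewrite Texp exprS Km KP subrr.
have charK : 'X * char_poly transition = ('X - 1%:P) * 'X^n.
  pose B := char_poly_mx (transition - u *m v).
  have Bu : B *m map_mx polyC u = 'X *: map_mx polyC u.
    rewrite /B /char_poly_mx mulmxBl mul_scalar_mx -map_mxM mulmxBl Ku.
    by rewrite -mulmxA vu mulmx1 subrr map_mx0 subr0.
  have := det_rank1_update (map_mx polyC v) Bu.
  have <- : char_poly_mx transition = B - map_mx polyC u *m map_mx polyC v.
    by rewrite /B /char_poly_mx -map_mxM map_mxB opprB addrA addrAC addrK.
  rewrite -map_mxM vu map_mx1 mxE -polyC1 -[\det B]/(char_poly _).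
  by rewrite (char_poly_nilpotent T0).
apply/eqP; rewrite -(eqr_nat rat); apply/eqP.
have S_eq := sum_char_poly_funmx A0; set S := \sum_f _ in S_eq.
have SX : 'X * S = (a ^+ n)%:P * (('X - 1%:P) * 'X^n) by rewrite S_eq mulrCA charK.
have S1 : S.[1] = 0.
  have /(congr1 (horner_eval 1)) := SX; rewrite /horner_eval !hornerM hornerX.
  by rewrite hornerXsubC subrr mul0r mulr0 mul1r.
have /(congr1 (fun p => p^`().[1])) := SX.
rewrite !derivM derivX derivXsubC derivC.
rewrite !(mul1r, mul0r, add0r) !(hornerD, hornerN, hornerM, hornerX, hornerC, hornerXn).
rewrite S1 subrr !(mul1r, mul0r, addr0, add0r) expr1n mulr1 => dS.
transitivity S^`().[1]; last by rewrite dS natrX.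
rewrite /S raddf_sum -[_.[1]]/(horner_eval 1 _) raddf_sum /=.
rewrite /horner_eval (eq_bigr _ (fun f _ => deriv_char_poly_funmx _)) -natr_sum.
congr _%:R; rewrite -sum1dep_card (eq_bigr _ (fun f _ => esym (sum1_card _))).
rewrite pair_big_dep /= (reindex (fun p : 'I_n * {ffun 'I_n -> A} => (p.2, p.1))) /=; last first.
  by exists (fun p => (p.2, p.1)) => -[].
by apply: eq_bigl => p; rewrite inE.
Qed.
End Choices.

End Determinants.

Lemma fconnect_conj (T T' : finType) (h : T -> T') (g : T -> T) (g' : T' -> T') x y :
  injective h -> (forall z, g' (h z) = h (g z)) ->
  fconnect g' (h x) (h y) = fconnect g x y.
Proof.
move=> hI gh; have gh_iter i : iter i g' (h x) = h (iter i g x).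
  by elim: i => //= i ->.
apply/idP/idP => [/iter_findex|/iter_findex <-]; last by rewrite -gh_iter fconnect_iter.
by rewrite gh_iter => /hI <-; apply: fconnect_iter.
Qed.

Theorem card_rooted (V A : finType) (step : V -> A -> V) m :
    0 < #|V| -> 0 < #|A| ->
    (forall x y, #|[set w : m.-tuple A | foldl step x w == y]| = 1) ->
  #|[set p | rooted step p]| = #|A| ^ #|V|.
Proof.
move=> V0 A0 unique_walk.
pose step' (i : 'I_#|V|) c := enum_rank (step (enum_val i) c).
pose toI (p : V * {ffun V -> A}) : 'I_#|V| * {ffun 'I_#|V| -> A} :=
  (enum_rank p.1, [ffun i => p.2 (enum_val i)]).
have foldE i w : foldl step' i w = enum_rank (foldl step (enum_val i) w).
  by elim: w i => [|c w IHw] i /=; rewrite ?enum_valK // IHw enum_rankK.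
rewrite -(@card_rooted_ord _ _ step' m) // => [|i j]; last first.
  rewrite -(unique_walk (enum_val i) (enum_val j)); apply: eq_card => w.
  by rewrite !inE foldE (can2_eq enum_rankK enum_valK).
rewrite -(on_card_preimset (f := toI)); last first.
  pose toV (q : 'I_#|V| * {ffun 'I_#|V| -> A}) : V * {ffun V -> A} :=
    (enum_val q.1, [ffun x => q.2 (enum_rank x)]).
  exists toV => [[v f]|[i f]] _.
    by congr (_, _); rewrite /= ?enum_rankK //; apply/ffunP => x; rewrite !ffunE enum_rankK.
  by congr (_, _); rewrite /= ?enum_valK //; apply/ffunP => x; rewrite !ffunE enum_valK.
apply: eq_card => -[v f]; rewrite !inE /rooted /=.
have conj x :
    fconnect (fun i => step' i ([ffun i => f (enum_val i)] i)) (enum_rank x) (enum_rank v)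
    = fconnect (fun x => step x (f x)) x v.
  by apply: fconnect_conj => [|z]; [apply: enum_rank_inj | rewrite /step' ffunE enum_rankK].
apply/forallP/forallP => [H i|H x]; last by rewrite -conj.
by rewrite -(enum_valK i) conj.
Qed.

(** * Necklace graphs and words without wildcards *)

Section Necklace.
Variables (d m : nat) (A : finType).

(** The de Bruijn graph on words of length [m], times a directed cycle of length
    [d] that records the position modulo [d]; for [d = 1] it is the de Bruijn
    graph itself. *)
Definition necklace_step (x : 'I_d * m.-tuple A) (c : A) : 'I_d * m.-tuple A :=
  (ordS x.1, behead_tuple (rcons_tuple x.2 c)).

(** The edges into [(j, v)] are obtained by choosing the letter [b] that was
    shifted out. *)
Lemma necklace_balanced x :
  #|[pred e : _ * A | necklace_step e.1 e.2 == x]| = #|A|.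
Proof.
case: x => j v.
pose pre b : 'I_d * m.-tuple A * A := ((ord_pred j, belast_tuple b v), last b v).
have pre_inj : injective pre.
  move=> b b' [E1 E2]; have : b :: v = b' :: v by rewrite !lastI E1 E2.
  by case.
rewrite -[RHS]cardsT -(card_imset _ pre_inj); apply: eq_card => -[[i u] c].
rewrite !inE /necklace_step /=; apply/eqP/imsetP => [[Ej Ev]|[b _ [-> -> ->]]]; last first.
  by congr (_, _); rewrite ?ord_predK //; apply/val_inj; rewrite /= -lastI.
exists (head c (rcons u c)) => //; rewrite /pre -Ej ordSK.
have E : head c (rcons u c) :: v = rcons u c by rewrite -Ev /=; case: (tval u).
have [Eu Ec] : belast (head c (rcons u c)) v = u /\ last (head c (rcons u c)) v = c.
  by move: E; rewrite lastI => /rcons_inj[].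
by congr (_, _, _) => //; apply/val_inj.
Qed.

Lemma necklace_foldl x w :
  (foldl necklace_step x w).2 = drop (size w) (x.2 ++ w) :> seq A.
Proof.
elim: w x => [|c w IHw] x /=; first by rewrite cats0 drop0.
by rewrite IHw /=; case: x.2 => -[|b u] ? //=; rewrite cat_rcons.
Qed.

Definition windows n (s : seq A) := [seq take n (drop i s) | i <- iota 0 ((size s).+1 - n)].

Lemma windows_cons n s : n < size s ->
  windows n.+1 s = take n.+1 s :: windows n.+1 (behead s).
Proof.
case: s => // c s; rewrite ltnS => ns; rewrite /windows !subSS (subSn ns) /=.
congr (_ :: _); rewrite -[1]addn0 iotaDl -map_comp.
exact: eq_map.
Qed.

(** An edge from [u] labelled [c] is the word [rcons u c], so the edges of a
    trail are the windows of the word that it spells. *)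
Lemma trail_windows x w :
  [seq rcons (tval e.1.2) e.2 | e : 'I_d * m.-tuple A * A <- trail necklace_step x w]
  = windows m.+1 (x.2 ++ w).
Proof.
elim: w x => [|c w IHw] [i u] /=.
  by rewrite cats0 /windows size_tuple subSS subnn.
rewrite IHw [RHS]windows_cons; last by rewrite size_cat size_tuple /=; lia.
congr (_ :: _) => /=.
  by rewrite -cat_rcons take_size_cat // size_rcons size_tuple.
by rewrite -cat_rcons; case: (tval u).
Qed.

End Necklace.

Section TotalWords.
Variables (A : finType) (m : nat).
Implicit Type s : seq A.

Lemma total_covers n s (v : n.-tuple A) i :
  word_covers (map Some s) v i <-> i + n <= size s /\ take n (drop i s) = v.
Proof.
rewrite /word_covers size_map; split=> -[le_is H]; split=> //.
  have sz : size (take n (drop i s)) = n.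
    rewrite size_take_min size_drop; apply/minn_idPl.
    by rewrite leq_subRL ?(leq_trans _ le_is) ?leq_addr.
  case: n v le_is sz H => [|n] v le_is sz H; first by rewrite take0 (tuple0 v).
  apply: (@eq_from_nth _ (thead v)); rewrite sz ?size_tuple // => k kn.
  have := H (Ordinal kn); rewrite nth_take // nth_drop (tnth_nth (thead v)) /=.
  by rewrite (nth_map (thead v)) // (leq_trans _ le_is) // ltn_add2l.
move=> k; rewrite (nth_map (tnth v k)); last by rewrite (leq_trans _ le_is) // ltn_add2l.
by rewrite /= [RHS](tnth_nth (tnth v k)) -H nth_take // nth_drop.
Qed.

Lemma size_windows n s w : w \in windows n s -> size w = n.
Proof.
case/mapP=> i; rewrite mem_iota /= add0n ltn_subRL => lt_i ->.
by rewrite size_take_min size_drop; lia.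
Qed.

Lemma mem_windows n s (v : n.-tuple A) i : 
  word_covers (map Some s) v i <->
  i < size (windows n s) /\ nth [::] (windows n s) i = v.
Proof.
rewrite total_covers size_map size_iota ltn_subRL ltnS addnC.
have nthE : n + i <= size s -> nth [::] (windows n s) i = take n (drop i s).
  move=> le_is; have lt_i : i < (size s).+1 - n by rewrite ltn_subRL.
  by rewrite (nth_map 0) ?size_iota // nth_iota.
by split=> -[le_is]; rewrite nthE.
Qed.

Lemma upword_windows n s : upword n (map Some s) <->
  uniq (windows n s) /\ size (windows n s) = #|A| ^ n.
Proof.
have tup w : w \in windows n s -> exists v : n.-tuple A, w = v.
  by move/size_windows/eqP => wn; exists (Tuple wn).
have sz_enum : size [seq val v | v <- enum {: n.-tuple A}] = #|A| ^ n.
  by rewrite size_map -cardE card_tuple.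
split=> [up|[uw sw] v].
  have uw : uniq (windows n s).
    apply/(uniqP [::]) => i j; rewrite !inE => lt_i lt_j Eij.
    have [v Ev] := tup _ (mem_nth [::] lt_i).
    have [k [_ kP]] := up v.
    rewrite -(kP i) ?mem_windows // -(kP j) // mem_windows.
    by rewrite -Eij.
  split=> //; rewrite -sz_enum; apply/perm_size/uniq_perm => //.
    by rewrite (map_inj_uniq val_inj) enum_uniq.
  move=> w; apply/idP/mapP => [/tup[v ->]|[v _ ->]]; first by exists v; rewrite ?mem_enum.
  by have [i [/mem_windows[lt_i /= <-] _]] := up v; apply: mem_nth.
have v_in : tval v \in windows n s.
  have /uniq_min_size : uniq (windows n s) := uw.
  move/(_ [seq val v | v <- enum {: n.-tuple A}]); rewrite sz_enum sw leqnn.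
  case=> [w /tup[t ->]|//|_ ->]; first by apply/mapP; exists t; rewrite ?mem_enum.
  by apply/mapP; exists v; rewrite ?mem_enum.
exists (index (tval v) (windows n s)); split.
  by rewrite mem_windows index_mem nth_index.
move=> i /mem_windows[lt_i <-]; exact: index_uniq.
Qed.

Hypothesis A0 : 0 < #|A|.

Lemma upword_total s : upword m.+1 (map Some s) <->
  uniq (windows m.+1 s) /\ size s = #|A| ^ m.+1 + m.
Proof.
rewrite upword_windows size_map size_iota subSS.
have : 0 < #|A| ^ m.+1 by rewrite expn_gt0 A0.
by split=> -[uw sz]; split=> //; lia.
Qed.

Lemma eulerian_total (u : m.-tuple A) w :
  eulerian (@necklace_step 1 m A) (ord0, u) w <-> upword m.+1 (map Some (u ++ w)).
Proof.
rewrite upword_total -(trail_windows (ord0 : 'I_1, u)) size_cat size_tuple.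
rewrite map_inj_uniq; last first.
  move=> [[i1 u1] c1] [[i2 u2] c2] /= /rcons_inj[/val_inj -> ->].
  by rewrite !ord1.
rewrite addnC /eulerian card_prod card_ord card_tuple mul1n -expnSr.
by split=> [/andP[-> /eqP ->]|[-> /addIn ->]] //=.
Qed.

Theorem card_debruijn_tours :
  #|tours (@necklace_step 1 m A)| = #|A| `! ^ (#|A| ^ m).
Proof.
have [c0 _] := card_gt0P A0.
have cardV : #|{: 'I_1 * m.-tuple A}| = #|A| ^ m.
  by rewrite card_prod card_ord card_tuple mul1n.
rewrite (card_tours (@necklace_balanced 1 m A) c0) (@card_rooted _ _ _ m) //.
- by rewrite cardV -expnMn -{1}(prednK A0) -factS prednK.
- by rewrite cardV expn_gt0 A0.
move=> x [i u]; rewrite -[RHS](cards1 u); apply: eq_card => w; rewrite !inE.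
rewrite -val_eqE -[_ == (i, u)]/((_ == i) && (_ == u)) !ord1 eqxx /= -val_eqE /=.
by rewrite necklace_foldl size_tuple drop_size_cat ?size_tuple.
Qed.

End TotalWords.

(** * Perfect necklaces *)

Section Exists.
Variables (V A : finType) (step : V -> A -> V).
Hypothesis balanced : forall x, #|[pred e : V * A | step e.1 e.2 == x]| = #|A|.

(** It suffices to order the exits at each [x] so that [h x] comes last. *)
Lemma eulerian_exists v (h : V -> A) :
  (forall x, fconnect (fun x => step x (h x)) x v) ->
  exists w, eulerian step v w.
Proof.
move=> conn; pose s x := rcons (rem (h x) (enum A)) (h x).
have lastE : (fun x => step x (last (h v) (s x))) =1 (fun x => step x (h x)).
  by move=> x; rewrite last_rcons.
have [|||Ew _] := @run_eulerian _ _ _ balanced (h v) v s;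
  last by exists (run step (#|V| * #|A|) v s).
- by move=> x; rewrite rcons_uniq rem_uniq ?enum_uniq // mem_rem_uniqF ?enum_uniq.
- move=> x; have hx : h x \in enum A by rewrite mem_enum.
  by rewrite size_rcons size_rem // -cardE prednK //; apply/card_gt0P; exists (h x).
by move=> x; rewrite (eq_fconnect lastE).
Qed.

Lemma nth_trail v w e0 c i : i < size w ->
  nth e0 (trail step v w) i = (foldl step v (take i w), nth c w i).
Proof. by elim: w v i => [|b w IHw] v [|i] //= /IHw ->. Qed.
End Exists.

Section Perfect.
Variables (d m : nat) (B : finType).
Hypotheses (d0 : 0 < d) (B0 : 0 < #|B|).
Let step := @necklace_step d m B.

Lemma necklace_residue x w : (foldl step x w).1 = (x.1 + size w) %% d :> nat.
Proof.
elim: w x => [|c w IHw] x /=; first by rewrite addn0 modn_small.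
by rewrite IHw /= modnDml addSnnS.
Qed.

(** Repeating the letter [b] at least [m] times leads to the constant word, and
    the number of repetitions can be adjusted modulo [d]. *)
Lemma necklace_connect (j : 'I_d) b x : j = 0 :> nat ->
  fconnect (step^~ b) x (j, nseq_tuple m b).
Proof.
move=> j0; pose i := m * d + (d - x.1).
suff <- : iter i (step^~ b) x = (j, nseq_tuple m b) by apply: fconnect_iter.
have iterE k : iter k (step^~ b) x = foldl step x (nseq k b).
  by elim: k => // k IHk; rewrite -addn1 nseqD foldl_cat /= addn1 iterS IHk.
have im : m <= i by rewrite (leq_trans _ (leq_addr _ _)) ?leq_pmulr.
apply/eqP; rewrite iterE -pair_eqE /= -!val_eqE /= necklace_residue size_nseq j0.
rewrite necklace_foldl size_nseq drop_cat size_tuple ltnNge im /= drop_nseq.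
rewrite subKn // eqxx andbT addnC -addnA subnK; last exact: ltnW.
by rewrite -mulSnr modnMl.
Qed.

(** Repeat an Eulerian trail of the necklace graph periodically.  The edge at
    time [i + m] is the window at [i] together with [i + m] modulo [d], so the
    windows at positions [r + q * d] within one period are distinct; there are
    as many of them as words of length [m.+1]. *)
Theorem perfect_necklace : exists y : nat -> B, forall r (z : m.+1.-tuple B),
  exists! q, q < #|B| ^ m.+1 /\ forall t : 'I_m.+1, y (r + q * d + t) = tnth z t.
Proof.
have [b _] := card_gt0P B0; pose v0 : 'I_d * m.-tuple B := (Ordinal d0, nseq_tuple m b).
have balanced := @necklace_balanced d m B.
have [w Ew] : exists w, eulerian step v0 w.
  by apply: (eulerian_exists balanced (h := fun=> b)) => x; apply: necklace_connect.
pose P := size w; pose y i := nth b w (i %% P); pose st i := foldl step v0 (mkseq y i).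
have PE : P = d * #|B| ^ m.+1.
  by case/andP: Ew => _ /eqP; rewrite card_prod card_ord card_tuple -mulnA -expnSr.
have P0 : 0 < P by rewrite PE muln_gt0 d0 expn_gt0 B0.
have yP i : y (i %% P) = y i by rewrite /y modn_mod.
have take_w i : i <= P -> mkseq y i = take i w.
  move=> iP; apply: (@eq_from_nth _ b) => [|k]; rewrite size_mkseq ?size_takel // => ki.
  by rewrite nth_mkseq // nth_take // /y modn_small // (leq_trans ki).
have stS i : st i.+1 = step (st i) (y i) by rewrite /st mkseqS foldl_rcons.
have stP i : st (i + P) = st i.
  elim: i => [|i IHi]; last by rewrite addSn !stS IHi -(yP (i + P)) modnDr yP.
  rewrite add0n /st take_w // take_size (eulerian_closed _ Ew) //.
have stE i : st i = st (i %% P).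
  rewrite {1}(divn_eq i P); elim: (i %/ P) => // k IHk.
  by rewrite mulSn -addnA addnC stP IHk.
have st_inj i j : st i = st j -> y i = y j -> i = j %[mod P].
  rewrite stE (stE j) -(yP i) -(yP j).
  have:= ltn_pmod i P0; have:= ltn_pmod j P0.
  move: (i %% P) (j %% P) => {}i {}j jP iP Est Ey.
  have /andP[uw _] := Ew.
  apply/eqP; rewrite -(nth_uniq (v0, b) _ _ uw) ?size_trail //.
  rewrite !(nth_trail _ _ _ b) // -!take_w ?(ltnW iP) ?(ltnW jP) // -!/(st _) Est.
  by move: Ey; rewrite /y !modn_small // => ->.
have win i : (st (i + m)).2 = mkseq (fun t => y (i + t)) m :> seq B.
  have -> : st (i + m) = foldl step (st i) (mkseq (fun t => y (i + t)) m).
    rewrite /st -foldl_cat; congr foldl.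
    elim: (m) => [|k IHk]; first by rewrite addn0 cats0.
    by rewrite addnS !mkseqS IHk rcons_cat.
  by rewrite necklace_foldl size_mkseq drop_size_cat ?size_tuple.
have res i : (st i).1 = i %% d :> nat by rewrite necklace_residue size_mkseq.
have y_inj i j : i = j %[mod d] ->
    (forall t, t < m.+1 -> y (i + t) = y (j + t)) -> i = j %[mod P].
  move=> ij Ey; apply/eqP; rewrite -(eqn_modDr m); apply/eqP/st_inj; last exact: Ey.
  apply/eqP; rewrite -pair_eqE /= -!val_eqE /= !res !win; apply/andP; split.
    by rewrite -(modnDml i) ij modnDml.
  apply/eqP/eq_in_map => t; rewrite mem_iota => /andP[_ tm]; apply: Ey.
  exact: leqW.
exists y => r.
pose F (q : 'I_(#|B| ^ m.+1)) := [tuple y (r + q * d + t) | t < m.+1].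
have F_inj : injective F.
  move=> q q' EF; apply/val_inj => /=.
  have : r + q * d = r + q' * d %[mod P].
    apply: y_inj => [|t tm]; first by rewrite !(addnC r) !modnMDl.
    by have /(congr1 (fun z => tnth z (Ordinal tm))) := EF; rewrite !tnth_mktuple.
  move/eqP; rewrite eqn_modDl PE ![_ * d]mulnC -!muln_modr eqn_pmul2l //.
  by rewrite !modn_small // => /eqP.
have [G FK GK] : bijective F by apply: inj_card_bij F_inj _; rewrite card_ord card_tuple.
move=> z; exists (G z); split=> [|q []].
  split=> // t. by rewrite -[z in RHS]GK tnth_mktuple.
move=> lt_q yq; have -> : z = F (Ordinal lt_q).
  by apply: eq_from_tnth => t; rewrite tnth_mktuple -yq.
by rewrite FK.
Qed.
End Perfect.

Lemma upword_map (A A' : Type) (f : A -> A') n u :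
  bijective f -> upword n u -> upword n (map (omap f) u).
Proof.
move=> [g fK gK] up v.
have nthE i : nth None (map (omap f) u) i = omap f (nth None u i).
  have [lt_i|le_i] := ltnP i (size u); first exact: nth_map.
  by rewrite !nth_default ?size_map.
have coversE i : word_covers (map (omap f) u) v i <-> word_covers u (map_tuple g v) i.
  rewrite /word_covers size_map; split=> -[le_i H]; split=> // k; move: (H k).
    by rewrite nthE tnth_map; case: nth => //= c <-.
  by rewrite nthE tnth_map; case: nth => //= c ->.
have [i [/coversE iP i_uniq]] := up (map_tuple g v).
by exists i; split=> // j /coversE; apply: i_uniq.
Qed.

Definition mixed_upword (A : eqType) n (w : seq (option A)) :=
  [/\ upword n w, None \in w & exists c, Some c \in w].

Lemma mixed_upword_card (A A' : finType) n : #|A| = #|A'| ->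
  (exists w : seq (option A), mixed_upword n w) ->
  exists w : seq (option A'), mixed_upword n w.
Proof.
move=> eqA [w [up_w N_w [c c_w]]].
pose f (x : A) : A' := enum_val (cast_ord eqA (enum_rank x)).
have f_bij : bijective f.
  exists (fun y => enum_val (cast_ord (esym eqA) (enum_rank y))) => x; rewrite /f.
    by rewrite enum_valK cast_ordK enum_rankK.
  by rewrite enum_valK cast_ordKV enum_rankK.
exists (map (omap f) w); split; first exact: upword_map.
  by apply/mapP; exists None.
by exists (f c); apply/mapP; exists (Some c).
Qed.

(** * Lifting a cyclic upword to a larger alphabet *)

Section Lift.
Variables (M m : nat) (B : finType) (u : seq (option bool)).
Let n := m.+2.
Let L := M * n.
Hypotheses (B0 : 0 < #|B|) (M0 : 0 < M) (size_u : size u = L).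
Hypothesis diamonds : forall i, i < L -> (nth None u i == None) = (i %% n == n.-1).
(* Repeating the first [n.-1] entries makes the windows those of [u] read
   cyclically. *)
Hypothesis up_u : upword n (u ++ take n.-1 u).

Definition letters_before i := i - i %/ n.

(** The window at [r] has its wildcard at offset [n.-1 - r %% n], which [bump]
    skips; so its letters are consecutive among all letters. *)
Lemma letters_before_bump r s : s < m.+1 ->
  letters_before (r + bump (n.-1 - r %% n) s) = letters_before r + s.
Proof.
move=> sm; rewrite /letters_before /bump.
have n0 : 0 < n by [].
have := ltn_pmod r n0; set b := r %% n => bn.
have Er := divn_eq r n; rewrite -/b in Er; set a := r %/ n in Er *.
have step1 t : (r + t) %/ n = a + (b + t) %/ n by rewrite Er -addnA divnMDl.
have le_ar : a <= r by apply: leq_div.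
rewrite step1; case: leqP => [le_s|lt_s] /=.
  rewrite (_ : b + (1 + s) = 1 * n + (b + s - n.-1)); last by rewrite /n /= in le_s *; lia.
  by rewrite divnMDl // divn_small; rewrite /n /= in le_s bn *; lia.
by rewrite divn_small; rewrite /n /= in lt_s bn *; lia.
Qed.

Lemma mod_bump r s : s < m.+1 -> (r + bump (n.-1 - r %% n) s) %% n != n.-1.
Proof.
move=> sm; rewrite -modnDml /bump.
have := ltn_pmod r (isT : 0 < n); set b := r %% n => bn.
case: leqP => [le_s|lt_s] /=.
  rewrite (_ : b + (1 + s) = b + s - n.-1 + n); last by rewrite /n /= in le_s *; lia.
  by rewrite modnDr modn_small; rewrite /n /= in le_s bn *; lia.
by rewrite modn_small; rewrite /n /= in lt_s bn *; lia.
Qed.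

Lemma mod_wildcard r : (r + (n.-1 - r %% n)) %% n = n.-1.
Proof.
have le_r : r %% n <= n.-1 by have := ltn_pmod r (isT : 0 < n).
by rewrite -modnDml subnKC // modn_small.
Qed.

Lemma letters_before_period r q :
  letters_before (r + q * L) = letters_before r + q * (M * m.+1).
Proof.
rewrite /letters_before /L mulnA addnC divnMDl //.
have := leq_div r n; rewrite [in X in X + _]/n mulnS mulnA; lia.
Qed.

Let d := M * m.+1.
Let K := #|B| ^ m.+1.

(** A word over [bool * B] is covered at [i] when its first components are
    covered by [u] at [i %% L], which determines [r = i %% L], and its second
    components, except the one under the wildcard, are read in [y] from
    [letters_before i] on, which determines [i %/ L]. *)
Theorem upcycle_lift : exists w : seq (option (bool * B)), mixed_upword n w.
Proof.
have d0 : 0 < d by rewrite muln_gt0 M0.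
have [y yP] := perfect_necklace m d0 B0; rewrite -/K in yP.
have L0 : 0 < L by rewrite muln_gt0 M0.
have K0 : 0 < K by rewrite expn_gt0 B0.
have n1L : n.-1 <= L by rewrite (leq_trans (leq_pred _)) // leq_pmull.
pose letter i := omap (fun b => (b, y (letters_before i))) (nth None u (i %% L)).
pose w := mkseq letter (L * K + n.-1).
have nth_cyc r k : r < L -> k < n ->
    nth None (u ++ take n.-1 u) (r + k) = nth None u ((r + k) %% L).
  move=> rL kn; rewrite nth_cat size_u; case: ltnP => [lt_rk|le_rk].
    by rewrite modn_small.
  have lt_rk : r + k - L < n.-1 by rewrite /n /= in kn *; lia.
  rewrite nth_take // -{2}(subnK le_rk) modnDr modn_small //.
  exact: leq_trans lt_rk n1L.
have mod_n i : (i %% L) %% n = i %% n by rewrite modn_dvdm // dvdn_mull.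
have letter_None i : (letter i == None) = (i %% n == n.-1).
  by rewrite /letter -mod_n -diamonds ?ltn_mod //; case: nth.
exists w; split; first last.
- have : letter 0 != None by rewrite letter_None mod0n.
  case E: (letter 0) => [c|//] _; exists c; rewrite -E; apply: map_f.
  by rewrite mem_iota add0n addn_gt0 muln_gt0 L0 K0.
- have /eqP <- : letter n.-1 == None by rewrite letter_None modn_small.
  apply: map_f; rewrite mem_iota add0n /= -[X in X < _]add0n ltn_add2r.
  by rewrite muln_gt0 L0.
move=> v; pose x := map_tuple fst v.
have [r [[le_r r_fits] r_uniq]] := up_u x.
have {le_r}rL : r < L.
  by move: le_r; rewrite size_cat size_takel size_u //; rewrite /n /=; lia.
have t0_lt : n.-1 - r %% n < n by rewrite ltnS leq_subr.
pose t0 : 'I_n := Ordinal t0_lt.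
pose z := [tuple (tnth v (lift t0 s)).2 | s < m.+1].
have period_n i k : (i + k) %% n = (i %% L + k) %% n by rewrite -[in RHS]modnDml mod_n modnDml.
have fits_r i : i %% L = r <-> forall k : 'I_n, fills (nth None u ((i + k) %% L)) (tnth x k).
  have fits k : nth None u ((i + k) %% L) = nth None u ((i %% L + k) %% L) by rewrite modnDml.
  split=> [Er k|H].
    by have := r_fits k; rewrite nth_cyc // -Er fits.
  apply/esym/r_uniq; split=> [|k]; last by rewrite nth_cyc ?ltn_mod // -fits.
  by rewrite size_cat size_takel size_u //; have := ltn_pmod i L0; rewrite /n /=; lia.
have coversE i : word_covers w v i <->
    [/\ i < L * K, i %% L = r &
        forall s : 'I_m.+1, y (letters_before r + i %/ L * d + s) = tnth z s].
  have -> : word_covers w v i <->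
      i < L * K /\ forall k : 'I_n, fills (letter (i + k)) (tnth v k).
    rewrite /word_covers size_mkseq.
    have -> : (i + n <= L * K + n.-1) = (i < L * K) by rewrite /n /=; lia.
    have bound a b c k : a < b -> k < c -> a + k < b + c.-1 by lia.
    split=> -[lt_i H]; split=> // k; have := H k.
      by rewrite nth_mkseq // bound.
    by rewrite nth_mkseq // bound.
  have lettersE s : i %% L = r ->
      letters_before (i + lift t0 s) = letters_before r + i %/ L * d + s.
    move=> Er; rewrite {1}(divn_eq i L) Er -addnA addnC letters_before_period.
    by rewrite letters_before_bump ?ltn_ord // addnAC.
  split=> [[lt_i H]|[lt_i Er y_i]].
    have Er : i %% L = r.
      apply/fits_r => k; have := H k; rewrite /letter tnth_map.
      by case: nth => //= b <-.
    split=> // s; have := H (lift t0 s).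
    case E: (letter _) => [c|]; last first.
      move/eqP: E; rewrite letter_None period_n Er => E.
      by have := mod_bump r (ltn_ord s); rewrite E.
    move: E; rewrite /letter tnth_mktuple -lettersE //.
    by case: nth => //= b [<-] /= <-.
  split=> // k; have /fits_r/(_ k) := Er.
  have [s ->|->] := unliftP t0 k; last first.
    suff /eqP -> : letter (i + t0) == None by [].
    by rewrite letter_None period_n Er mod_wildcard.
  rewrite /letter tnth_map; case: nth => //= b ->.
  by rewrite lettersE // y_i tnth_mktuple; case: (tnth v _).
have [q [[lt_q q_y] q_uniq]] := yP (letters_before r) z.
have rq_mod : (r + q * L) %% L = r by rewrite addnC modnMDl modn_small.
exists (r + q * L); split=> [|i].
  apply/coversE; split.
    by rewrite (leq_trans (n := L + q * L)) ?ltn_add2r // -mulSn mulnC leq_pmul2l.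
    by [].
  by move=> s; rewrite [r + _]addnC divnMDl // divn_small // addn0; apply: q_y.
case/coversE => lt_i Er y_i.
rewrite (q_uniq (i %/ L)); last first.
  by split; [rewrite ltn_divLR // mulnC | exact: y_i].
by rewrite addnC -Er -divn_eq.
Qed.
End Lift.

(** * Explicit cyclic upwords over two letters *)

Fixpoint bitseqs n : seq bitseq :=
  if n is n'.+1 then [seq false :: s | s <- bitseqs n'] ++ [seq true :: s | s <- bitseqs n']
  else [:: [::]].

Lemma mem_bitseqs s : s \in bitseqs (size s).
Proof.
elim: s => //= b s IHs; rewrite mem_cat; case: b; apply/orP; [right|left]; exact: map_f.
Qed.

Fixpoint fitsb (w : seq (option bool)) (v : bitseq) : bool :=
  match v, w with
  | c :: v', o :: w' => (if o is Some b then b == c else true) && fitsb w' v'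
  | [::], _ => true
  | _, [::] => false
  end.

Definition upwordb n (u : seq (option bool)) :=
  let suffixes := [seq drop i u | i <- iota 0 (size u).+1] in
  all (fun v => count (fitsb^~ v) suffixes == 1) (bitseqs n).

Lemma fitsbP w v :
  reflect (size v <= size w /\ forall k, k < size v -> fills (nth None w k) (nth false v k))
          (fitsb w v).
Proof.
elim: v w => [|c v IHv] [|o w] /=; [by left | by left | by right; case |].
apply: (iffP andP) => [[oc /IHv[le_vw vw]]|[le_vw vw]]; last first.
  split; first by have := vw 0 isT; case: (o) => //= b ->.
  by apply/IHv; split=> // k kv; apply: (vw k.+1).
by split=> // -[|k] kv; [case: o oc => //= b /eqP | apply: vw].
Qed.

Lemma upwordbP n u : upwordb n u -> upword n u.
Proof.
move=> /allP up v.
have coversP i : reflect (word_covers u v i) ((i < (size u).+1) && fitsb (drop i u) v).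
  apply: (iffP andP) => [[le_i /fitsbP[le_v fit]]|[le_i fit]].
    rewrite size_tuple size_drop in le_v fit.
    split=> [|k]; first by lia.
    by have := fit k (ltn_ord k); rewrite nth_drop (tnth_nth false).
  split; first by lia.
  apply/fitsbP; rewrite size_tuple size_drop; split=> [|k kn]; first by lia.
  by have := fit (Ordinal kn); rewrite nth_drop (tnth_nth false).
have v_in : tval v \in bitseqs n by rewrite -{2}(size_tuple v) mem_bitseqs.
have := up _ v_in; rewrite count_map -size_filter; set s := filter _ _ => s1.
have mem_s i : (i \in s) = (i < (size u).+1) && fitsb (drop i u) v.
  by rewrite mem_filter mem_iota /= add0n andbC.
case: s s1 mem_s => [|i [|? ?]] //= _ mem_s.
exists i; split; first by apply/coversP; rewrite -mem_s inE.
by move=> j /coversP; rewrite -mem_s inE => /eqP.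
Qed.

Definition upcycle4 : seq (option bool) :=
  let o := Some false in let l := Some true in let d := None in
  [:: o; o; l; d; l; l; o; d].

(** The windows of a cyclic upword with one wildcard per eight positions match the
    vertices of the 8-cube along 16 edges in each direction.  This one comes
    from a matching in which each direction class is a union of cosets of a plane
    of [F_2^7], by an Eulerian trail through the words that are left when the
    wildcards are erased. *)
Definition upcycle8 : seq (option bool) :=
  let o := Some false in let l := Some true in let d := None in
  [:: o; o; o; o; l; l; l; d;  l; l; l; l; o; o; o; d;
      o; o; l; o; l; l; l; d;  l; o; o; l; l; o; o; d;
      o; o; l; o; o; l; l; d;  l; l; o; l; o; l; o; d;
      o; o; l; o; l; o; l; d;  l; l; o; l; o; o; o; d;
      o; l; l; o; o; o; l; d;  l; o; o; l; l; l; o; d;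
      o; l; l; o; o; l; l; d;  l; o; l; l; l; o; o; d;
      o; l; l; o; l; l; l; d;  l; l; o; l; l; o; o; d;
      o; l; o; o; o; l; l; d;  l; o; o; l; o; o; o; d].

Lemma upcycle_liftb (M m : nat) (B : finType) u (n := m.+2) :
    0 < #|B| -> 0 < M -> size u = M * n ->
    all (fun i => (nth None u i == None) == (i %% n == n.-1)) (iota 0 (M * n)) ->
    upwordb n (u ++ take n.-1 u) ->
  exists w : seq (option (bool * B)), mixed_upword n w.
Proof.
move=> B0 M0 size_u /allP diam up; apply: (upcycle_lift B0 M0 size_u) => [i lt_i|].
  by have := diam i; rewrite mem_iota => /(_ lt_i)/eqP.
exact: upwordbP.
Qed.

Theorem even_upword a n : 1 < a -> ~~ odd a -> n = 4 \/ n = 8 ->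
  exists w : seq (option 'I_a), mixed_upword n w.
Proof.
move=> a1 a_even n48; have B0 : 0 < #|'I_(a./2)| by rewrite card_ord half_gt0.
apply: (@mixed_upword_card (bool * 'I_(a./2))%type).
  by rewrite card_prod card_bool !card_ord mul2n even_halfK.
case: n48 => ->.
  by apply: (@upcycle_liftb 2 2 _ upcycle4 B0 isT (erefl _)); vm_compute.
by apply: (@upcycle_liftb 16 6 _ upcycle8 B0 isT (erefl _)); vm_compute.
Qed.

(** * Wildcards in front, over two letters *)

(** A window covers [v] when its 0 lies under the last [false] of [v], or when it
    consists of ones and [v] has no [false]. *)
Lemma upword_diamonds_first m :
  upword m.+1 (mkseq (fun j => if j < m then None else Some (m < j)) (m + m.+2)).
Proof.
set u := mkseq _ _ => v.
have coversE i : word_covers u v i <->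
    i <= m.+1 /\ forall k, k <= m -> m <= i + k -> nth false v k = (m < i + k).
  rewrite /word_covers size_mkseq.
  have -> : (i + m.+1 <= m + m.+2) = (i <= m.+1) by lia.
  split=> -[le_i H]; split=> // k.
    move=> km le_m; have := H (Ordinal (km : k < m.+1)).
    by rewrite (tnth_nth false) nth_mkseq /= 1?ltnNge ?le_m //=; lia.
  have kn := ltn_ord k; rewrite nth_mkseq; last by lia.
  by case: ltnP => //= le_m; rewrite (tnth_nth false) H.
pose r := rev v; pose i0 := index false r.
have size_r : size r = m.+1 by rewrite size_rev size_tuple.
have le_i0 : i0 <= m.+1 by rewrite -size_r index_size.
have nth_r j : j <= m -> nth false v (m - j) = nth false r j.
  by move=> jm; rewrite nth_rev size_tuple ?subSS.
have r_before j : j < i0 -> nth false r j = true.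
  by move=> /(before_find false) /=; case: nth.
have r_at : i0 <= m -> nth false r i0 = false.
  by move=> le_i0m; apply: nth_index; rewrite -index_mem size_r.
exists i0; split=> [|i /coversE[le_i H]].
  apply/coversE; split=> // k km le_m.
  rewrite -{1}(subKn km) nth_r ?leq_subr //.
  have [lt_m|eq_m] : m < i0 + k \/ m = i0 + k by lia.
    by rewrite lt_m r_before //; lia.
  have -> : m - k = i0 by lia.
  by rewrite eq_m ltnn r_at //; lia.
case: (ltngtP i0 i) => // [lt_i|lt_i].
  have le_m : i0 <= m by lia.
  have := H _ (leq_subr i0 m); rewrite nth_r // r_at //; lia.
have le_m : i <= m by lia.
by have := H _ (leq_subr i m); rewrite nth_r // r_before // subnKC // ltnn leqnn => /(_ isT).
Qed.

Lemma mixed_diamonds_first m :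
  mixed_upword m.+2
    (mkseq (fun j => if j < m.+1 then None else Some (m.+1 < j)) (m.+1 + m.+3)).
Proof.
split; first exact: upword_diamonds_first.
  by apply/mapP; exists 0.
exists true; apply/mapP; exists m.+2; first by rewrite mem_iota; lia.
by rewrite ltnNge leqnSn ltnSn.
Qed.

(** * From words to matrices *)

(** A matrix with [p] rows fits into the [p] rows of [mu w p] only from row 0 on,
    and below the top row nothing is required of it. *)
Lemma mu_covers (A : Type) p n (w : seq (option A)) (t : 'M[A]_(p, n)) (p0 : 0 < p) ij :
  matrix_covers (mu w p) t ij <->
  ij.1 = 0 /\ word_covers w [tuple t (Ordinal p0) k | k < n] ij.2.
Proof.
rewrite /matrix_covers /word_covers /=; split=> [[le_i le_j H]|[-> [le_j H]]].
  have i0 : ij.1 = 0 by lia.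
  split=> //; split=> // k; rewrite tnth_mktuple.
  have lt_j : ij.2 + k < size w by rewrite (leq_trans _ le_j) // ltn_add2l.
  have := H (Ordinal p0) k (Ordinal p0) (Ordinal lt_j) _ erefl.
  by rewrite mxE /= i0; apply.
split=> // x y i j Ei Ej; rewrite mxE; case: eqP => // i0.
have -> : x = Ordinal p0 by apply: val_inj => /=; lia.
by have := H y; rewrite tnth_mktuple -Ej.
Qed.

Lemma mu_upword_upmatrix (A : Type) p n (w : seq (option A)) :
  0 < p -> upword n w -> upmatrix p n (mu w p).
Proof.
move=> p0 up t; have [j [cj j_uniq]] := up [tuple t (Ordinal p0) k | k < n].
exists (0, j); split; first by apply/(mu_covers _ _ p0).
by move=> [i k] /(mu_covers _ _ p0)[/= -> /j_uniq ->].
Qed.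

Lemma top_row_mu (A : Type) p (w : seq (option A)) x : 0 < p ->
  top_row (mu w p) x <-> exists2 j, j < size w & nth None w j = x.
Proof.
move=> p0; split=> [[i [j [i0 <-]]]|[j lt_j <-]].
  by exists j => //; rewrite mxE i0 eqxx.
by exists (Ordinal p0), (Ordinal lt_j); rewrite mxE.
Qed.

(** Witnesses that [mu w p] determines [w]. *)
Definition first_row (A : Type) (M : pmatrix A) : seq (option A) :=
  if insub 0 is Some i then [seq M i j | j <- enum 'I_(ncols M)] else [::].

Lemma mu_first_row (A : Type) p (w : seq (option A)) : 0 < p -> first_row (mu w p) = w.
Proof.
move=> p0; rewrite /first_row insubT /=; apply: (@eq_from_nth _ None).
  by rewrite size_map -cardE card_ord.
move=> j; rewrite size_map -cardE card_ord => lt_j.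
rewrite (nth_map (Ordinal lt_j)) -?cardE ?card_ord // mxE /=.
by rewrite nth_enum_ord.
Qed.

(** One word without wildcards, taken for windows of length 2 so that the
    blocks have more than one column, gives a matrix for each [p]. *)
Theorem infinite_nontrivial_mu (A : finType) : 0 < #|A| ->
  infinite_set [set M : pmatrix A |
       (exists r l : nat, [/\ 0 < r, 0 < l & nontrivial_upmatrix r l M]) /\
       (exists (n p : nat) (w : seq (option A)),
          [/\ 0 < n, 2 <= p, upword n w & M = mu w p])]%classic.
Proof.
move=> A0.
have [[x w] Ew] : exists p, p \in tours (@necklace_step 1 1 A).
  by apply/card_gt0P; rewrite card_debruijn_tours // expn_gt0 fact_gt0.
pose W := map Some (x.2 ++ w) : seq (option A).
have up_W : upword 2 W.
  by rewrite inE /= in Ew; case: x @W Ew => i u W; rewrite (ord1 i) eulerian_total.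
have size_W : 0 < size W by rewrite size_map size_cat size_tuple.
have W0 : nth None W 0 <> None by move: size_W; rewrite /W; case: (_ ++ _).
pose f k := mu W k.+2.
have f_inj : injective f by move=> k l /(congr1 (@nrows A)) [].
rewrite infiniteP -(card_le_eql (inj_card_eq (A := [set: nat]%classic) (in2W f_inj))).
apply: subset_card_le => _ [k _ <-]; split; last by exists 2, k.+2, W.
exists k.+2, 2; split=> //; split; first exact: mu_upword_upmatrix.
case=> // [letters|diamonds].
  have := letters (Ordinal (isT : 1 < k.+2)) (Ordinal size_W).
  by rewrite mxE.
have := diamonds (Ordinal (isT : 0 < k.+2)) (Ordinal size_W).
by rewrite mxE.
Qed.

Lemma total_mu_iff (A : finType) p (w : seq (option A)) : 0 < p ->
  ~ top_row (mu w p) None <-> exists s, w = map Some s.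
Proof.
move=> p0; split=> [nN|[s ->]]; last first.
  move/(top_row_mu _ _ p0) => [j]; rewrite size_map => lt_j.
  by case: s lt_j => // c s lt_j; rewrite (nth_map c).
exists (pmap id w).
elim: w nN => //= -[c|] w IHw nN; last first.
  by case: nN; apply/top_row_mu => //; exists 0.
congr (_ :: _); apply: IHw => /(top_row_mu _ _ p0) [j lt_j wj].
by case: nN; apply/top_row_mu => //; exists j.+1.
Qed.

Theorem card_total_mu (A : finType) m p : 0 < #|A| -> 0 < p ->
  ([set M : pmatrix A | mu_upmatrix p m.+1 M /\ ~ top_row M None]%classic
     #= `I_(#|A| `! ^ (#|A| ^ m)))%card.
Proof.
move=> A0 p0; rewrite -(card_debruijn_tours m A0); set T := tours _.
pose E := #|{: 'I_1 * m.-tuple A}| * #|A|.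
pose word (e : 'I_1 * m.-tuple A * E.-tuple A) : seq A := e.1.2 ++ e.2.
pose h (i : 'I_#|T|) := mu (map Some (word (enum_val i))) p.
have h_inj : injective h.
  move=> i j /(congr1 (@first_row _)); rewrite !mu_first_row // => /(inj_map Some_inj).
  rewrite /word => /eqP; rewrite eqseq_cat ?size_tuple // => /andP[/eqP E2 /eqP E3].
  apply: enum_val_inj; case: (enum_val i) (enum_val j) E2 E3 => [[i1 u1] w1] [[i2 u2] w2] /=.
  by move=> /val_inj -> /val_inj ->; rewrite !ord1.
suff -> : [set M | mu_upmatrix p m.+1 M /\ ~ top_row M None]%classic
        = [set h i | i in [set: 'I_#|T|]]%classic.
  by rewrite (card_eqr card_II) (card_eql (inj_card_eq (in2W h_inj))) card_eqxx.
apply/seteqP; split=> [M [[_ [w [up_w ->]]] /total_mu_iff-/(_ p0)[s Es]]|M [i _ <-]].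
  rewrite {}Es {w} in up_w *.
  have [_ size_s] := (upword_total m A0 s).1 up_w.
  have size_u : size (take m s) == m by rewrite size_takel // size_s leq_addl.
  have size_v : size (drop m s) == #|{: 'I_1 * m.-tuple A}| * #|A|.
    by rewrite size_drop size_s addnK card_prod card_ord card_tuple mul1n -expnSr.
  pose e : 'I_1 * m.-tuple A * E.-tuple A := ((ord0, Tuple size_u), Tuple size_v).
  have eT : e \in T by rewrite inE eulerian_total //= cat_take_drop.
  exists (enum_rank_in eT e) => //.
  by rewrite /h enum_rankK_in //= /word /= cat_take_drop.
have up : upword m.+1 (map Some (word (enum_val i))).
  have := enum_valP i; rewrite inE /word; case: (enum_val i) => [[i1 u1] w1] /=.
  by rewrite (ord1 i1) eulerian_total.
split; last by apply/total_mu_iff => //; exists (word (enum_val i)).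
split; first exact: mu_upword_upmatrix.
by exists (map Some (word (enum_val i))).
Qed.

Lemma mixed_mu (A : eqType) n p (w : seq (option A)) : 0 < p -> mixed_upword n w ->
  exists M : pmatrix A,
    [/\ mu_upmatrix p n M, top_row M None & exists c : A, top_row M (Some c)].
Proof.
move=> p0 [up_w /(nthP None) N_w [c /(nthP None) c_w]]; exists (mu w p); split.
- by split; [apply: mu_upword_upmatrix | exists w].
- exact/top_row_mu.
by exists c; apply/top_row_mu.
Qed.

Local Open Scope classical_set_scope.
Local Open Scope card_scope.

Theorem corollary4p2 :
  (forall A : finType, 0 < #|A| ->
     infinite_set [set M : pmatrix A |
       (exists r l : nat, [/\ 0 < r, 0 < l & nontrivial_upmatrix r l M]) /\
       (exists (n p : nat) (w : seq (option A)),
          [/\ 0 < n, 2 <= p, upword n w & M = mu w p])]) /\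
  (forall a n p : nat, 2 <= a -> 1 <= n -> 2 <= p ->
     [set M : pmatrix 'I_a | mu_upmatrix p n M /\ ~ top_row M None]
       #= `I_(a`! ^ (a ^ n.-1))) /\
  (forall n p : nat, 2 <= n -> 2 <= p ->
     exists M : pmatrix 'I_2,
       [/\ mu_upmatrix p n M,
           top_row M None &
           exists c : 'I_2, top_row M (Some c)]) /\
  (forall a n p : nat, 2 <= a -> ~~ odd a -> n = 4 \/ n = 8 -> 2 <= p ->
     exists M : pmatrix 'I_a,
       [/\ mu_upmatrix p n M,
           top_row M None &
           exists c : 'I_a, top_row M (Some c)]).
Proof.
split; first exact: infinite_nontrivial_mu.
split=> [a [//|m] p a2 _ p2|].
  by have := @card_total_mu 'I_a m p; rewrite card_ord; apply; exact: ltnW.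
split=> [[|[|m]] p // _ p2|a n p a2 a_even n48 p2]; last first.
  by have [w mix_w] := even_upword a2 a_even n48; apply: mixed_mu mix_w; apply: ltnW.
have [|w mix_w] := @mixed_upword_card bool 'I_2 m.+2 _ (ex_intro _ _ (mixed_diamonds_first m)).
  by rewrite card_bool card_ord.
by apply: mixed_mu mix_w; apply: ltnW.
Qed.
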